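(* Let $\overline{A_0A_1A_2A_3}$ be a tetrahedron in $\mathbb{A}^3$ with $B$-quadrances $Q_{ij}$, $B$-quadrume $\mathcal{V}$, and skew $B$-quadrances $R_{01;23}$, $R_{02;13}$, $R_{03;12}$ (where the vectors $n_{01;23}$, $n_{02;13}$, $n_{03;12}$ defining them are not $B$-null). Then $$R_{01;23}=\frac{\mathcal{V}}{4Q_{01}Q_{23}-(Q_{02}+Q_{13}-Q_{03}-Q_{12})^2},$$ $$R_{02;13}=\frac{\mathcal{V}}{4Q_{02}Q_{13}-(Q_{01}+Q_{23}-Q_{03}-Q_{12})^2},$$ $$R_{03;12}=\frac{\mathcal{V}}{4Q_{03}Q_{12}-(Q_{01}+Q_{23}-Q_{02}-Q_{13})^2}.$$
   Context: Let $\mathbb{F}$ be a field of characteristic not $2$, $\mathbb{V}^3=\mathbb{F}^3$ the space of row vectors, and $\mathbb{A}^3$ the three-dimensional affine space over $\mathbb{F}$ with associated vector space $\mathbb{V}^3$; $\overrightarrow{XY}=Y-X$ for points $X,Y$. Let $B$ be a symmetric invertible $3\times3$ matrix over $\mathbb{F}$. Define $v\cdot_B w=vBw^T$, $Q_B(v)=v\cdot_B v$ (a vector $v$ is $B$-null if $Q_B(v)=0$), $v\times_B w=(v\times w)\,\mathrm{adj}\,B$ where $\times$ is the usual cross product and $\mathrm{adj}\,B=(\det B)B^{-1}$, and $[v_1,v_2,v_3]_B=v_1\cdot_B(v_2\times_B v_3)$. For $Q_B(u)\neq0$, the $B$-projection of $v$ in the direction $u$ is $\mathrm{proj}_u v=\frac{u\cdot_B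 v}{Q_B(u)}u$. A tetrahedron $\overline{A_0A_1A_2A_3}$ is a collection of four points of $\mathbb{A}^3$. Its $B$-quadrances are $Q_{ij}=Q_B(\overrightarrow{A_iA_j})$ (symmetric in $i,j$). Its $B$-quadrume is $\mathcal{V}=\frac{4}{\det B}[\overrightarrow{A_0A_1},\overrightarrow{A_0A_2},\overrightarrow{A_0A_3}]_B^2$. For $(ij;kl)\in\{(01;23),(02;13),(03;12)\}$ put $n_{ij;kl}=\overrightarrow{A_iA_j}\times_B\overrightarrow{A_kA_l}$. The skew $B$-quadrance is $R_{ij;kl}=Q_B\big(\mathrm{proj}_{n_{ij;kl}}\overrightarrow{P_{ij}P_{kl}}\big)$, where $P_{ij}$ is an arbitrary point on the line $A_iA_j$ and $P_{kl}$ an arbitrary point on the line $A_kA_l$ (the value does not depend on these choices). *)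

(* Defs.v *)
From mathcomp Require Import all_boot all_algebra.

Set Implicit Arguments.
Unset Strict Implicit.
Unset Printing Implicit Defensive.

Import GRing.Theory.
Local Open Scope ring_scope.

Section BGeometry.
Variable F : fieldType.

(* Affine 3-space is taken in its coordinate model: points and vectors are both
   row vectors, and the vector from X to Y is Y - X. *)
Definition vec (X Y : 'rV[F]_3) : 'rV[F]_3 := Y - X.

Definition on_line (X Y P : 'rV[F]_3) : Prop :=
  exists t : F, P = X + t *: vec X Y.

Definition cross (v w : 'rV[F]_3) : 'rV[F]_3 :=
  \row_j [:: v 0 1 * w 0 2 - v 0 2 * w 0 1;
             v 0 2 * w 0 0 - v 0 0 * w 0 2;
             v 0 0 * w 0 1 - v 0 1 * w 0 0]`_j.

Variable B : 'M[F]_3.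

Definition Bdot (v w : 'rV[F]_3) : F := (v *m B *m w^T) 0 0.

Definition Bquad (v : 'rV[F]_3) : F := Bdot v v.

Definition Bnull (v : 'rV[F]_3) : Prop := Bquad v = 0.

(* For invertible B, \adj B = \det B *: invmx B. *)
Definition Bcross (v w : 'rV[F]_3) : 'rV[F]_3 := cross v w *m \adj B.

Definition Btriple (v1 v2 v3 : 'rV[F]_3) : F := Bdot v1 (Bcross v2 v3).

(* Meaningful only when u is not B-null. *)
Definition Bproj (u v : 'rV[F]_3) : 'rV[F]_3 := (Bdot u v / Bquad u) *: u.

Variable A : 'I_4 -> 'rV[F]_3.

Definition quadrance (i j : 'I_4) : F := Bquad (vec (A i) (A j)).

Definition quadrume : F :=
  4 / \det B * Btriple (vec (A 0) (A 1)) (vec (A 0) (A 2)) (vec (A 0) (A 3)) ^+ 2.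

Definition normal (i j k l : 'I_4) : 'rV[F]_3 :=
  Bcross (vec (A i) (A j)) (vec (A k) (A l)).

(* P and P' stand for the chosen points on the lines A_i A_j and A_k A_l. *)
Definition skew_quadrance (i j k l : 'I_4) (P P' : 'rV[F]_3) : F :=
  Bquad (Bproj (normal i j k l) (vec P P')).

End BGeometry.

(* Main.v *)
Require Import Defs.
From mathcomp Require Import all_boot all_algebra.
From mathcomp Require Import ring.

Set Implicit Arguments.
Unset Strict Implicit.
Unset Printing Implicit Defensive.

Import GRing.Theory.
Local Open Scope ring_scope.

(** A B-projection satisfies Q_B(proj_u v) = (u ._B v)^2 / Q_B(u), so a skew
    quadrance is the quotient of two quantities attached to the normal
    n = XY x_B ZW of the opposite edges XY and ZW.

    The numerator is a volume.  Moving P along XY and P' along ZW changes PP'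
    by multiples of the two directions, to which n is B-orthogonal; so
    n ._B PP' = n ._B XZ, which up to sign is the B-triple product of the three
    edges issuing from X ([skew_triple], [Btriple_det]).  Relabelling the
    vertices changes that triple product at most by a sign, which the square
    forgets: the three skew quadrances share the same quadrume.

    The denominator is a Gram determinant.  The Lagrange identity
    Q_B(v x_B w) = det B (Q_B(v) Q_B(w) - (v ._B w)^2) ([Bquad_Bcross]) holds
    because the adjugate transports the cross product, (vM) x (wM) =
    (v x w) (adj M)^T ([cross_mulmx]), which reduces it to the Euclidean
    Binet-Cauchy identity ([dot_cross_cross]).  Finally v ._B w for opposite
    edges v, w is half an alternating sum of four quadrances
    ([Bdot_opposite_edges]); clearing that half brings in the factors 4 of the
    quadrume and of the denominator, which cancel away from characteristic 2.
    These combine in [skew_quadrance_edges], for any labelling of the vertices,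
    of which the three formulas are instances. *)

Section Euclidean.
Variable F : fieldType.
Implicit Types u v w x : 'rV[F]_3.

Definition dot u v : F := (u *m v^T) 0 0.

Lemma dotE u v : dot u v = u 0 0 * v 0 0 + u 0 1 * v 0 1 + u 0 2 * v 0 2.
Proof.
rewrite /dot !mxE !big_ord_recl big_ord0 !mxE addr0 addrA.
by do 2?congr (_ + _); congr (_ * _); congr (_ _ _); apply: val_inj.
Qed.

Lemma dotC u v : dot u v = dot v u.
Proof. by rewrite !dotE; ring. Qed.

Lemma crossE v w :
  (cross v w 0 0 = v 0 1 * w 0 2 - v 0 2 * w 0 1) *
  (cross v w 0 1 = v 0 2 * w 0 0 - v 0 0 * w 0 2) *
  (cross v w 0 2 = v 0 0 * w 0 1 - v 0 1 * w 0 0).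
Proof. by rewrite !mxE. Qed.

Lemma rV3P u v :
  u 0 0 = v 0 0 -> u 0 1 = v 0 1 -> u 0 2 = v 0 2 -> u = v.
Proof.
move=> e0 e1 e2; apply/rowP; case=> [[|[|[|//]]] lt_i].
- by rewrite (_ : Ordinal _ = 0) //; apply: val_inj.
- by rewrite (_ : Ordinal _ = 1) //; apply: val_inj.
- by rewrite (_ : Ordinal _ = 2) //; apply: val_inj.
Qed.

Lemma mulrV3E u (M : 'M[F]_3) j :
  (u *m M) 0 j = u 0 0 * M 0 j + u 0 1 * M 1 j + u 0 2 * M 2 j.
Proof.
rewrite !mxE !big_ord_recl big_ord0 addr0 addrA.
by do 2?congr (_ + _); congr (_ * _); congr (_ _ _); apply: val_inj.
Qed.

Lemma det2 (M : 'M[F]_2) : \det M = M 0 0 * M 1 1 - M 0 1 * M 1 0.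
Proof.
rewrite (expand_det_row _ 0) !big_ord_recl big_ord0 /cofactor !det_mx11 !mxE.
have -> : lift 0 0 = 1 :> 'I_2 by apply: val_inj.
have -> : lift 1 0 = 0 :> 'I_2 by apply: val_inj.
by rewrite /= expr0 expr1; ring.
Qed.

Lemma cofactor3 (M : 'M[F]_3) (i j i1 i2 j1 j2 : 'I_3) :
  lift i 0 = i1 -> lift i 1 = i2 -> lift j 0 = j1 -> lift j 1 = j2 ->
  cofactor M i j =
  (-1) ^+ (i + j) * (M i1 j1 * M i2 j2 - M i1 j2 * M i2 j1).
Proof. by move=> <- <- <- <-; rewrite /cofactor det2 !mxE. Qed.

(** The coordinates of (v M) x (w M) are 2 x 2 minors of a product, and the
    cofactors of M are its own 2 x 2 minors: this is the Cauchy-Binet formula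
    for the second exterior power in dimension 3. *)
Lemma cross_mulmx v w (M : 'M[F]_3) :
  cross (v *m M) (w *m M) = cross v w *m (\adj M)^T.
Proof.
have c0 j j1 j2 := @cofactor3 M 0 j 1 2 j1 j2.
have c1 j j1 j2 := @cofactor3 M 1 j 0 2 j1 j2.
have c2 j j1 j2 := @cofactor3 M 2 j 0 1 j1 j2.
have adjTE i j : (\adj M)^T i j = cofactor M i j by rewrite !mxE.
apply: rV3P; rewrite crossE !mulrV3E !crossE !adjTE.
- rewrite (c0 0 1 2) ?(c1 0 1 2) ?(c2 0 1 2); try exact: val_inj.
  by rewrite /=; ring.
- rewrite (c0 1 0 2) ?(c1 1 0 2) ?(c2 1 0 2); try exact: val_inj.
  by rewrite /=; ring.
- rewrite (c0 2 0 1) ?(c1 2 0 1) ?(c2 2 0 1); try exact: val_inj.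
  by rewrite /=; ring.
Qed.

Lemma dot_cross_cross u v w x :
  dot (cross u v) (cross w x) = dot u w * dot v x - dot u x * dot v w.
Proof. by rewrite !dotE !crossE; ring. Qed.

(** The volume spanned by two opposite edges XY, ZW and a segment joining their
    lines is, up to sign, that of the tetrahedron XYZW, because shearing along
    the edges preserves volumes. *)
Lemma skew_triple X Y Z W P P' :
  on_line X Y P -> on_line Z W P' ->
  dot (vec P P') (cross (vec X Y) (vec Z W)) =
  - dot (vec X Y) (cross (vec X Z) (vec X W)).
Proof. by move=> [s ->] [t ->]; rewrite /vec !dotE !crossE !mxE; ring. Qed.

End Euclidean.

Section Symmetric.
Variables (F : fieldType) (B : 'M[F]_3).
Hypothesis Bsym : B^T = B.
Implicit Types u v w : 'rV[F]_3.

Lemma Bdot_dotl u v : Bdot B u v = dot (u *m B) v.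
Proof. by []. Qed.

Lemma Bdot_dotr u v : Bdot B u v = dot u (v *m B).
Proof. by rewrite /dot trmx_mul Bsym mulmxA. Qed.

Lemma BdotC u v : Bdot B u v = Bdot B v u.
Proof. by rewrite Bdot_dotl Bdot_dotr dotC. Qed.

Lemma BdotBl u v w : Bdot B (u - v) w = Bdot B u w - Bdot B v w.
Proof. by rewrite /Bdot !mulmxBl !mxE. Qed.

Lemma BdotBr u v w : Bdot B w (u - v) = Bdot B w u - Bdot B w v.
Proof. by rewrite !(BdotC w) BdotBl. Qed.

Lemma BdotZZ a u : Bdot B (a *: u) (a *: u) = a ^+ 2 * Bdot B u u.
Proof. by rewrite /Bdot linearZ /= -!scalemxAl -scalemxAr !mxE mulrA. Qed.

Lemma Btriple_det u v w : Btriple B u v w = \det B * dot u (cross v w).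
Proof.
rewrite /Btriple Bdot_dotr /dot /Bcross -mulmxA mul_adj_mx mul_mx_scalar.
by rewrite linearZ /= -scalemxAr mxE.
Qed.

(** Lagrange's identity for B: one of the two adjugates in the left-hand side
    meets B and leaves det B, the other transports the cross product, so that
    the Euclidean identity applies to v, w and their images under B. *)
Lemma Bquad_Bcross v w :
  Bquad B (Bcross B v w) =
  \det B * (Bquad B v * Bquad B w - Bdot B v w ^+ 2).
Proof.
rewrite -[LHS]/(Btriple B (Bcross B v w) v w) Btriple_det.
(* The adjugate of B inherits its symmetry. *)
have -> : Bcross B v w = cross (v *m B) (w *m B).
  by rewrite cross_mulmx trmx_adj Bsym.
by rewrite dot_cross_cross -!Bdot_dotl (BdotC w v) expr2.
Qed.

Lemma Bquad_Bproj u v :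
  Bquad B u != 0 -> Bquad B (Bproj B u v) = Bdot B u v ^+ 2 / Bquad B u.
Proof. by move=> u_n0; rewrite /Bquad BdotZZ -/(Bquad B u); field. Qed.

(** Expanded about a common origin, the alternating sum loses all its square
    terms: it is the polarization identity for two segments without a common
    endpoint. *)
Lemma Bdot_opposite_edges X Y Z W :
  2 * Bdot B (vec X Y) (vec Z W) =
  Bquad B (vec X W) + Bquad B (vec Y Z)
    - Bquad B (vec X Z) - Bquad B (vec Y W).
Proof.
rewrite /Bquad /vec !BdotBl !BdotBr.
by rewrite (BdotC W X) (BdotC Z Y) (BdotC Z X) (BdotC W Y); ring.
Qed.

Lemma quadranceC (A : 'I_4 -> 'rV[F]_3) i j :
  quadrance B A i j = quadrance B A j i.
Proof.
by rewrite /quadrance /vec /Bquad !BdotBl !BdotBr (BdotC (A i)); ring.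
Qed.

Lemma skew_quadrance_edges (A : 'I_4 -> 'rV[F]_3) (i j k l : 'I_4)
    (P P' : 'rV[F]_3) :
  2%N \notin [pchar F] -> \det B != 0 ->
  ~ Bnull B (normal B A i j k l) ->
  on_line (A i) (A j) P -> on_line (A k) (A l) P' ->
  let Q := quadrance B A in
  skew_quadrance B A i j k l P P' =
  4 / \det B
    * Btriple B (vec (A i) (A j)) (vec (A i) (A k)) (vec (A i) (A l)) ^+ 2
    / (4 * Q i j * Q k l - (Q i k + Q j l - Q i l - Q j k) ^+ 2).
Proof.
move=> two_n0 detB_n0 /eqP n_n0 hP hP' Q; rewrite inE /= in two_n0.
rewrite /skew_quadrance Bquad_Bproj // BdotC.
rewrite -[Bdot B _ _]/(Btriple B (vec P P') (vec (A i) (A j)) (vec (A k) (A l))).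
rewrite !Btriple_det (skew_triple hP hP').
have -> : Q i k + Q j l - Q i l - Q j k =
          - (2 * Bdot B (vec (A i) (A j)) (vec (A k) (A l))).
  by rewrite Bdot_opposite_edges /Q /quadrance; ring.
move: n_n0; rewrite /normal Bquad_Bcross mulf_eq0 negb_or => /andP[_].
rewrite -![Bquad B (vec _ _)]/(Q _ _); set g := Q i j * Q k l - _ => g_n0.
have four_n0 : 4 != 0 :> F by rewrite (natrM _ 2 2) mulf_neq0.
rewrite [4 * _ * _ - _](_ : _ = 4 * g); last by rewrite /g; ring.
by field; rewrite g_n0 detB_n0 four_n0.
Qed.

End Symmetric.

Theorem theorem24 (F : fieldType) (hF : 2%N \notin [pchar F])
  (B : 'M[F]_3) (Bsym : B^T = B) (Binv : B \in unitmx)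
  (A : 'I_4 -> 'rV[F]_3)
  (n0123 : ~ Bnull B (normal B A 0 1 2 3))
  (n0213 : ~ Bnull B (normal B A 0 2 1 3))
  (n0312 : ~ Bnull B (normal B A 0 3 1 2))
  (P01 P23 P02 P13 P03 P12 : 'rV[F]_3)
  (hP01 : on_line (A 0) (A 1) P01) (hP23 : on_line (A 2) (A 3) P23)
  (hP02 : on_line (A 0) (A 2) P02) (hP13 : on_line (A 1) (A 3) P13)
  (hP03 : on_line (A 0) (A 3) P03) (hP12 : on_line (A 1) (A 2) P12) :
  let Q := quadrance B A in
  let V := quadrume B A in
  [/\ skew_quadrance B A 0 1 2 3 P01 P23 =
        V / (4 * Q 0 1 * Q 2 3 - (Q 0 2 + Q 1 3 - Q 0 3 - Q 1 2) ^+ 2),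
      skew_quadrance B A 0 2 1 3 P02 P13 =
        V / (4 * Q 0 2 * Q 1 3 - (Q 0 1 + Q 2 3 - Q 0 3 - Q 1 2) ^+ 2) &
      skew_quadrance B A 0 3 1 2 P03 P12 =
        V / (4 * Q 0 3 * Q 1 2 - (Q 0 1 + Q 2 3 - Q 0 2 - Q 1 3) ^+ 2)].
Proof.
move=> Q V; have detB_n0 : \det B != 0 by rewrite -unitfE -unitmxE.
have skewE := skew_quadrance_edges Bsym hF detB_n0.
split.
- by rewrite (skewE _ _ _ _ _ _ _ n0123 hP01 hP23).
(* Permuting the vertices changes the triple product at most by a sign, so its
   square is the same as for the first formula. *)
- rewrite (skewE _ _ _ _ _ _ _ n0213 hP02 hP13) (quadranceC Bsym _ 2 1).
  congr (_ * _ / _); rewrite !Btriple_det // !dotE !crossE; ring.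
- rewrite (skewE _ _ _ _ _ _ _ n0312 hP03 hP12).
  rewrite (quadranceC Bsym _ 3 1) (quadranceC Bsym _ 3 2).
  congr (_ * _ / _); rewrite !Btriple_det // !dotE !crossE; ring.
Qed.
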